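(* Let $a_1\in(-1,0)$, let $\{\xi_i\}_{i\ge-1}$ be i.i.d. standard exponential random variables, and let $Z_i:=\xi_i+a_1\xi_{i-1}$ for $i\ge0$. Then $$\mathbb{P}\Big(\min_{0\le i\le n}Z_i\ge0\Big)=(1+a_1)^{n+o(n)}\quad(n\to\infty).$$
   Context: The notation $p_n=\lambda^{n+o(n)}$ with $\lambda\in(0,1)$ means $\lim_{n\to\infty}\frac1n\log p_n=\log\lambda$. The standard exponential distribution has density $e^{-y}$ on $(0,\infty)$. *)

(* Defs.v *)
From HB Require Import structures.
From mathcomp Require Import all_boot all_order all_algebra finmap.
From mathcomp Require Import all_classical all_reals all_analysis.

Set Implicit Arguments.
Unset Strict Implicit.
Unset Printing Implicit Defensive.

Import Order.TTheory GRing.Theory Num.Theory numFieldNormedType.Exports.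

Local Open Scope classical_set_scope.
Local Open Scope ring_scope.

(* Mutual independence of the subfamily of [X] indexed by [D]: the product
   rule holds over every finite set of indices taken in [D]. *)
Definition mutually_independent (d : measure_display) (T : measurableType d)
    (R : realType) (P : probability T R) (I : choiceType) (D : set I)
    (X : I -> {RV P >-> R}) : Prop :=
  forall (J : {fset I}) (B : I -> set R),
    [set` J] `<=` D ->
    (forall i, i \in J -> measurable (B i)) ->
    P (\bigcap_(i in [set` J]) (X i @^-1` B i)) =
    (\prod_(i <- J) P (X i @^-1` B i))%E.

Definition iid_with_law (d : measure_display) (T : measurableType d)
    (R : realType) (P : probability T R) (I : choiceType) (D : set I)
    (X : I -> {RV P >-> R}) (mu : set R -> \bar R) : Prop :=
  mutually_independent D X /\
  (forall i, D i -> forall A : set R, measurable A ->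
     distribution P (X i) A = mu A).

Definition MA1 (R : realType) (T : Type) (a1 : R) (xi : int -> T -> R)
    (i : nat) (w : T) : R :=
  xi i%:Z w + a1 * xi (i%:Z - 1) w.

(* The minimum of [Z 0], ..., [Z n]; the default value [Z 0] of the iterated
   minimum belongs to the family, so it does not affect the result. *)
Definition running_min (R : realType) (T : Type) (Z : nat -> T -> R)
    (n : nat) (w : T) : R :=
  \big[Num.min/Z 0%N w]_(0 <= i < n.+1) Z i w.

(* p_n = lambda^(n + o(n)).  The logarithm is the extended one, for which
   [lne 0 = -oo]: a vanishing p_n is not confused with p_n = 1. *)
Definition exp_decay (R : realType) (p : nat -> \bar R) (lambda : R) : Prop :=
  ((n%:R^-1)%:E * lne (p n))%E @[n --> \oo] --> (ln lambda)%:E.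

(* Main.v *)
Require Import Defs.
From HB Require Import structures.
From mathcomp Require Import all_boot all_order all_algebra finmap.
From mathcomp Require Import all_classical all_reals all_analysis.
From mathcomp Require Import measurable_realfun ring zify.
Import Order.TTheory GRing.Theory Num.Theory numFieldNormedType.Exports.
Local Open Scope classical_set_scope.
Local Open Scope ring_scope.

(* Put theta = - a1; the event is that xi i >= theta * xi (i - 1) for
   0 <= i <= n.  Revealing the variables backwards from xi n, the law of
   xi (n - k) restricted to the last k of these constraints is c_k times an
   exponential law of rate r_k, where r_0 = c_0 = 1: integrating exp(-x)
   against the tail exp(- r_k theta x) gives r_(k+1) = 1 + theta r_k and
   c_(k+1) = c_k / r_(k+1).  Hence the probability is exactly
   1 / (r_1 ... r_(n+1)) with r_k --> 1 / (1 - theta), and Cesaro's theorem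
   applied to the logarithms concludes. *)

(** * Tails of exponential laws and integration against them *)

Section exponential_law.
Context {R : realType}.
Local Notation mu := (@lebesgue_measure R).

(** The [Num.max] covers negative [a], where the tail has full mass; the formula is later applied at
    [theta * x] with [x] of any sign. *)
Lemma exponential_prob_itvcy (r a : R) : 0 < r ->
  exponential_prob r `[a, +oo[ = (expR (- (r * Num.max 0 a)))%:E.
Proof.
move=> r0; wlog a0 : a / 0 <= a.
  (* For [a < 0], the mass lies between that of the tail at 0, which is 1, and 1 itself. *)
  move=> tail_ge0; have [a0|a0] := lerP 0 a.
    by rewrite tail_ge0// max_r.
  have tail0 := tail_ge0 0 (lexx _); rewrite maxxx in tail0.
  apply/eqP; rewrite eq_le mulr0 oppr0 expR0 probability_le1//=.
  have <- : exponential_prob r `[0, +oo[ = 1%E.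
    by rewrite tail0 mulr0 oppr0 expR0.
  rewrite le_measure ?inE//.
  by apply: subset_itvr; rewrite bnd_simp ltW.
rewrite max_r// /exponential_prob.
rewrite (@ge0_continuous_FTC2y _ _ (fun x => - expR (- r * x)) a 0).
- by rewrite sub0e -EFinN opprK mulNr.
- by move=> x _; apply: exponential_pdf_ge0; exact: ltW.
- apply: (@continuous_subspaceW R^o _ _ [set` `[0, +oo[%R]).
    by apply: subset_itvr; rewrite bnd_simp.
  exact: within_continuous_exponential_pdf.
- rewrite -oppr0; apply: cvgN.
  rewrite (_ : (fun x => expR (- r * x)) =
               (fun z => expR (- z)) \o (fun z => r * z)); last first.
    by apply: eq_fun => x; rewrite mulNr.
  apply: (@cvg_comp _ _ _ _ _ _ (pinfty_nbhs R)); last exact: cvgr_expR.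
  exact: gt0_cvgMry.
- by move=> x _; exact: ex_derive.
- apply: cvgN; apply/cvg_at_right_filter.
  apply: continuous_comp; last exact: continuous_expR.
  by apply: continuousM; [exact: cst_continuous|exact: cvg_id].
- move=> x; rewrite in_itv/= andbT => ax.
  by apply: derive1_exponential_pdf; rewrite in_itv/= andbT (le_lt_trans a0).
Qed.

(** The exponential law is defined by integrating its density against [mu], so it is dominated by
    [mu] and its Radon-Nikodym derivative can be replaced by that density. *)
Lemma integral_exponential_prob (r : R) (r0 : 0 < r) (f : R -> \bar R)
    (U : set R) : measurable U -> (exponential_prob r).-integrable U f ->
  (\int[exponential_prob r]_(x in U) f x =
   \int[mu]_(x in U) (f x * (exponential_pdf r x)%:E))%E.
Proof.
move=> mU intf.
have dom : exponential_prob r `<< mu.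
  apply/null_content_dominatesP => A mA muA0.
  apply: null_set_integral => //=.
  apply: (measurable_funS measurableT) => //; apply/measurable_EFinP.
  exact: measurable_exponential_pdf.
rewrite -(Radon_Nikodym_change_of_variables dom)//=.
have mpdf : measurable_fun U (EFin \o exponential_pdf r).
  apply: (measurable_funS measurableT) => //; apply/measurable_EFinP.
  exact: measurable_exponential_pdf.
apply: ae_eq_integral => //.
- apply: emeasurable_funM => //; first exact: measurable_int intf.
  apply: (measurable_int mu); apply: (integrableS _ _ (@subsetT _ _)) => //=.
  exact: Radon_Nikodym_integrable.
- by apply: emeasurable_funM => //; exact: measurable_int intf.
(* The derivative and the density have the same integral over every measurable set, hence agree
   almost everywhere. *)
- apply: ae_eqe_mul2l => /=; rewrite Radon_NikodymE//=.
  case: cid => /= h [h1 h2 h3].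
  apply: integral_ae_eq => //=; first exact: integrableS h2.
  by move=> E EU mE; rewrite -h3.
Qed.

Lemma exponential_prob_setT (r : R) : 0 < r -> exponential_prob r setT = 1%E.
Proof. exact: integral_exponential_pdf. Qed.

(* The probability structure of exponential_prob r depends on 0 < r and is over
   the Borel structure measurableTypeR R, whose display is not that of R. *)
Lemma exists_exponential_probability (r : R) : 0 < r ->
  exists m : probability (measurableTypeR R) R,
    m = exponential_prob r :> (set R -> \bar R).
Proof. by move=> r0; unshelve eexists (exponential_prob r). Qed.

End exponential_law.

(** * Pairs of independent variables *)

Lemma measurable_ratio_ge (R : realType) (theta : R) (B : set R) :
  measurable B -> measurable [set z : R * R | B z.1 /\ theta * z.1 <= z.2].
Proof.
move=> mB; rewrite [X in measurable X](_ : _ =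
    (fst @^-1` B) `&` [set z : R * R | theta * z.1 <= z.2]); last by [].
apply: measurableI.
  by rewrite -[X in measurable X]setTI; exact: measurable_fst.
rewrite -[X in measurable X]setTI.
by apply: measurable_fun_le => //; exact: measurable_funM.
Qed.

(** For [x >= 0], the density [q exp(- q x)] times the tail [exp(- r theta x)] is
    [q / (q + theta r)] times the density of rate [q + theta r]. With [q = 1] this is one step of
    the recursion on rates. *)
Lemma exponential_prob_ratio_ge (R : realType) (q r theta : R) (B : set R)
    (q0 : 0 < q) (r0 : 0 < r) :
  0 <= theta -> measurable B ->
  (exponential_prob q \x exponential_prob r)%E
    [set z : R * R | B z.1 /\ theta * z.1 <= z.2] =
  ((q / (q + theta * r))%:E * exponential_prob (q + theta * r) B)%E.
Proof.
move=> theta0 mB; rewrite /product_measure1/=.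
(* The product measure integrates the masses of the sections; the section at [x] is a tail if [x] is
   in [B] and empty otherwise. *)
transitivity (\int[exponential_prob q]_(x in B)
   exponential_prob r `[(theta * x)%R, +oo[)%E.
  rewrite [RHS]integral_mkcond; apply: eq_integral => x _ /=.
  rewrite patchE; case: ifPn => xB.
    congr (exponential_prob r _); apply/seteqP; split=> y.
      by rewrite /xsection/= inE/= => -[_ ?]; rewrite in_itv/= andbT.
    rewrite /xsection/= in_itv/= inE/= andbT => ?.
    by split => //; apply/set_mem.
  rewrite (_ : xsection _ _ = set0) ?measure0//.
  rewrite -subset0 => y; rewrite /xsection/= inE/= => -[Bx _].
  by move/negP: xB; apply; rewrite inE.
under eq_integral do rewrite exponential_prob_itvcy//.
rewrite integral_exponential_prob//; last first.
  apply: measurable_bounded_integrable => //.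
  - by rewrite (le_lt_trans (probability_le1 _ _)) ?ltry.
  - apply: measurable_funTS; apply: measurableT_comp => //.
    apply: measurableT_comp => //; apply: measurable_funM => //.
    by apply: measurable_maxr => //; exact: measurable_funM.
  - exists 1; split => // M M1 x _ /=.
    rewrite ger0_norm ?expR_ge0// (le_trans _ (ltW M1))// -expR0 ler_expR.
    by rewrite oppr_le0 mulr_ge0 ?(ltW r0)// le_max lexx.
have qr0 : 0 < q + theta * r by rewrite ltr_wpDr// mulr_ge0// ltW.
rewrite /exponential_prob -ge0_integralZl//.
- apply: eq_integral => x _; rewrite -!EFinM; congr EFin.
  have [x0|x0] := leP 0 x; last by rewrite !lt0_exponential_pdf// !mulr0.
  rewrite !exponential_pdfE// max_r ?mulr_ge0// [RHS]mulrA divfK ?gt_eqF//.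
  rewrite mulrCA -expRD; congr (_ * expR _); ring.
- apply: measurable_funTS; apply/measurable_EFinP.
  exact: measurable_exponential_pdf.
- by move=> x _; rewrite lee_fin exponential_pdf_ge0// ltW.
- by rewrite lee_fin divr_ge0// ltW.
Qed.

(** Dividing by [P D] gives the conditional law of [(X, Y)] given [D]; it agrees with [m1 \x m2] on
    rectangles, hence everywhere by uniqueness of the product measure. If [P D] is 0, both sides
    vanish. *)
Lemma probability_pair_law (d d1 d2 : measure_display) (T : measurableType d)
    (T1 : measurableType d1) (T2 : measurableType d2) (R : realType)
    (P : probability T R) (X : T -> T1) (Y : T -> T2)
    (m1 : probability T1 R) (m2 : probability T2 R) (D : set T) :
  measurable_fun setT X -> measurable_fun setT Y -> measurable D ->
  (forall A B, measurable A -> measurable B ->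
     P (D `&` X @^-1` A `&` Y @^-1` B) = (P D * (m1 A * m2 B))%E) ->
  forall S : set (T1 * T2), measurable S ->
  P (D `&` [set w | S (X w, Y w)]) = (P D * (m1 \x m2) S)%E.
Proof.
move=> mX mY mD PD S mS.
have mXY : measurable_fun setT (fun w => (X w, Y w)).
  exact: measurable_fun_pair.
have [PD0|PD0] := eqVneq (P D) 0%E.
  rewrite PD0 mul0e; apply/eqP; rewrite eq_le measure_ge0 andbT -PD0.
  rewrite le_measure ?inE//.
  apply: measurableI => //; rewrite -[X in measurable X]setTI; exact: mXY.
have c0 : 0 <= (fine (P D))^-1 by rewrite invr_ge0 fine_ge0.
have [m' m'E] : exists m' : {measure set (T1 * T2) -> \bar R}, forall S,
    m' S = ((fine (P D))^-1%:E * P ([set w | S (X w, Y w)] `&` D))%E.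
  by unshelve eexists (mscale (NngNum c0)
    (pushforward (mrestr P mD) (fun w => (X w, Y w)))).
rewrite (@product_measure_unique _ _ _ _ _ m1 m2 m')//.
  rewrite m'E [in RHS]setIC muleA.
  rewrite -{1}[P D]fineK ?fin_num_measure// -EFinM.
  by rewrite mulfV ?mul1e// fine_eq0 ?fin_num_measure.
move=> A B mA mB; rewrite m'E.
rewrite (_ : _ `&` D = D `&` X @^-1` A `&` Y @^-1` B); last first.
  by apply/seteqP; split => w /=; tauto.
rewrite PD// muleA -{2}[P D]fineK ?fin_num_measure// -EFinM.
by rewrite mulVf ?mul1e// fine_eq0 ?fin_num_measure.
Qed.

(** * From a product of convergent factors to its exponential rate *)

Lemma exp_decay_prod (R : realType) (u : nat -> R) (l : R) (p : nat -> \bar R) :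
  0 < l -> (forall n, 0 < u n) -> u n @[n --> \oo] --> l ->
  (forall n, p n = (\prod_(0 <= k < n.+1) u k)%:E) ->
  exp_decay p l.
Proof.
move=> l0 u0 ul pE; rewrite /exp_decay.
have lnul : ln (u n) @[n --> \oo] --> ln l.
  apply: (@continuous_cvg _ _ _ _ _ _ (@ln R)) => //.
  exact: continuous_ln.
have lnp n : lne (p n) = (series (fun k => ln (u k)) n.+1)%:E.
  rewrite pE lne_EFin ?prodr_gt0// /series/= ; congr EFin.
  elim: n => [|n IHn]; first by rewrite !big_nat1.
  rewrite big_nat_recr//= lnM ?posrE ?prodr_gt0// IHn.
  by rewrite [in RHS]big_nat_recr.
(* There are n + 1 logarithms but the sum is divided by n; this ratio corrects the arithmetic mean.
   Shifting n by one avoids the zero denominator. *)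
have ratio : (n.+1%:R / n%:R : R) @[n --> \oo] --> (1 : R).
  rewrite -(cvg_shiftS (fun n => n.+1%:R / n%:R : R)) /=.
  rewrite (_ : (fun n => _) = (fun n => 1 + harmonic n)); last first.
    apply/funext => n; rewrite /harmonic/=.
    by rewrite [in LHS]mulrS mulrDl mul1r divff// addrC.
  have := cvgD (cvg_cst (1 : R)) (@cvg_harmonic R).
  by rewrite addr0; exact.
pose mean := arithmetic_mean (fun k => ln (u k)).
apply: (@cvg_trans _ ((n.+1%:R / n%:R * mean n)%:E @[n --> \oo])).
  apply: near_eq_cvg; near=> n.
  rewrite lnp -EFinM; congr EFin.
  rewrite /mean /arithmetic_mean mulrA; congr (_ * _).
  by rewrite mulrAC divff ?mul1r.
rewrite -[X in X%:E]mul1r.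
apply/cvg_EFin; first by near=> n.
by apply: cvgM ratio _; exact: cesaro.
Unshelve. all: by end_near. Qed.

(** * Chains of constraints, revealed downwards from the top index *)

Section ascending_chain.
Context {R : realType} (theta : R).

(** Closed form of the geometric sum [1 + theta + ... + theta ^+ k], from which positivity and the
    limit are read off. *)
Definition chain_rate (k : nat) : R := (1 - theta ^+ k.+1) / (1 - theta).

Context (theta01 : 0 < theta < 1).

Lemma chain_rate_gt0 k : 0 < chain_rate k.
Proof.
have /andP[t0 t1] := theta01.
by rewrite divr_gt0 ?subr_gt0// exprn_ilt1 ?ltW.
Qed.

Lemma chain_rateS k : chain_rate k.+1 = 1 + theta * chain_rate k.
Proof.
have /andP[t0 t1] := theta01.
rewrite /chain_rate [in LHS]exprS; field.
by rewrite subr_eq0 gt_eqF.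
Qed.

Lemma cvg_chain_rateV : (chain_rate n.+1)^-1 @[n --> \oo] --> 1 - theta.
Proof.
have /andP[t0 t1] := theta01.
have exp_cvg : theta ^+ n.+1 @[n --> \oo] --> 0.
  rewrite (cvg_shiftS (fun n => theta ^+ n)).
  by apply: cvg_expr; rewrite gtr0_norm.
have rate_cvg : chain_rate n @[n --> \oo] --> (1 - theta)^-1.
  have := cvgM (cvgB (cvg_cst (1 : R)) exp_cvg) (cvg_cst (1 - theta)^-1).
  by rewrite subr0 mul1r; exact.
rewrite (cvg_shiftS (fun n => (chain_rate n)^-1)).
have := @cvgV _ _ _ _ _ _ _ rate_cvg; rewrite invrK; apply.
by rewrite invr_eq0 subr_eq0 gt_eqF.
Qed.

Context (d : measure_display) (T : measurableType d) (P : probability T R)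
  (xi : int -> {RV P >-> R}).

(** Indices go down from [i], so that raising [k] by one adds a single constraint and reveals a
    single new variable, [xi (i - k.+1%:Z)]. *)
Definition chain_event (i : int) (k : nat) : set T :=
  [set w | forall j, (j < k)%N ->
     theta * xi (i - j.+1%:Z) w <= xi (i - j%:Z) w].

Lemma chain_event0 i : chain_event i 0 = setT.
Proof. by apply/seteqP; split. Qed.

Lemma chain_eventS i k : chain_event i k.+1 =
  chain_event i k `&`
  [set w | theta * xi (i - k.+1%:Z) w <= xi (i - k%:Z) w].
Proof.
apply/seteqP; split=> w /=.
  by move=> H; split=> [j jk|]; apply: H => //; exact: ltnW.
by move=> [H Hk] j; rewrite ltnS leq_eqVlt => /predU1P[->//|]; exact: H.
Qed.

Lemma measurable_chain_event i k : measurable (chain_event i k).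
Proof.
elim: k => [|k IHk]; first by rewrite chain_event0.
rewrite chain_eventS; apply: measurableI => //.
rewrite -[X in measurable X]setTI.
by apply: measurable_fun_le => //; exact: measurable_funM.
Qed.

Context
  (xi_iid : iid_with_law [set i : int | -1 <= i] xi (exponential_prob 1)).

(* The unrevealed variables, indexed by J, are carried along so that the
   induction on k needs only the product rule on finite sets of indices. *)
Lemma chain_event_law (n : int) (k : nat) (A : set R) (J : {fset int})
    (B : int -> set R) :
  -1 <= n - k%:Z -> measurable A -> (forall j, measurable (B j)) ->
  (forall j, j \in J -> -1 <= j < n - k%:Z) ->
  P (chain_event n k `&` xi (n - k%:Z) @^-1` A `&`
     \bigcap_(j in [set` J]) (xi j @^-1` B j)) =
  ((\prod_(0 <= l < k) (chain_rate l.+1)^-1)%:E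
   * exponential_prob (chain_rate k) A
   * \prod_(j <- J) P (xi j @^-1` B j))%E.
Proof.
have /andP[t0 t1] := theta01.
have [indep law] := xi_iid.
have lawE i C : -1 <= i -> measurable C ->
    P (xi i @^-1` C) = exponential_prob 1 C by move=> i1 mC; exact: law.
(* Overriding the family of events at one index lets a further variable join the unrevealed set with
   an event of its own. *)
pose upd (i : int) (A : set R) (B : int -> set R) j :=
  if j == i then A else B j.
have mupd i C E : measurable C -> (forall j, measurable (E j)) ->
    forall j, measurable (upd i C E j).
  by move=> mC mE j; rewrite /upd; case: ifP.
have updE i (C : set R) (E : int -> set R) j : j != i -> upd i C E j = E j.
  by rewrite /upd => /negbTE ->.
have capU i (I : {fset int}) C E : i \notin I ->
    \bigcap_(j in [set` (i |` I)%fset]) (xi j @^-1` upd i C E j) =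
    xi i @^-1` C `&` \bigcap_(j in [set` I]) (xi j @^-1` E j).
  move=> iI; rewrite bigcap_fsetU1 {1}/upd eqxx; congr (_ `&` _).
  apply: eq_bigcapr => j /= jI; rewrite updE//.
  by apply: contraNneq iI => <-.
have prodU i (I : {fset int}) C E : i \notin I ->
    (\prod_(j <- (i |` I)%fset) P (xi j @^-1` upd i C E j) =
    P (xi i @^-1` C) * \prod_(j <- I) P (xi j @^-1` E j))%E.
  move=> iI; rewrite big_fsetU1//= {1}/upd eqxx; congr (_ * _)%E.
  rewrite big_seq [RHS]big_seq; apply: eq_bigr => j jI; rewrite updE//.
  by apply: contraNneq iI => <-.
elim: k A J B => [|k IHk] A J B n1 mA mB Jlt.
  rewrite chain_event0 setTI big_nil mul1e.
  rewrite subr0 in n1 Jlt *.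
  have nJ : n \notin J by apply/negP => /Jlt; rewrite ltxx andbF.
  rewrite -capU// indep; last 2 first.
  - by move=> j; rewrite /= in_fset1U => /predU1P[->//|/Jlt/andP[]].
  - by move=> j _; exact: mupd.
  rewrite prodU// lawE// /chain_rate expr1 divff//.
  by rewrite subr_eq0 gt_eqF.
have nk1 : -1 <= n - k%:Z by lia.
have iJ : n - k.+1%:Z \notin J by apply/negP => /Jlt; rewrite ltxx andbF.
have Jlt' j : j \in (n - k.+1%:Z |` J)%fset -> -1 <= j < n - k%:Z.
  by rewrite in_fset1U => /predU1P[->|/Jlt]; lia.
have Jlt'' j : j \in J -> -1 <= j < n - k%:Z by move/Jlt; lia.
set c := (\prod_(0 <= l < k) _)%:E in IHk.
set X := xi (n - k.+1%:Z); set Y := xi (n - k%:Z).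
set G := \bigcap_(j in _) _.
set p := (\prod_(j <- J) _)%E.
have mG : measurable G.
  by apply: fin_bigcap_measurable => // j _; exact: measurable_funPTI.
have mD : measurable (chain_event n k `&` G).
  by apply: measurableI => //; exact: measurable_chain_event.
have rk0 := chain_rate_gt0 k.
have PD : P (chain_event n k `&` G) = (c * p)%E.
  have := IHk setT J B nk1 measurableT mB Jlt''.
  rewrite preimage_setT setIT => ->.
  by rewrite exponential_prob_setT// mule1.
(* The induction hypothesis with [n - k.+1%:Z] added to [J] shows that, given [chain_event n k] and
   [G], the variables [X] and [Y] are independent, with exponential laws of rates 1 and
   [chain_rate k]. *)
have XYlaw C E : measurable C -> measurable E ->
    P (chain_event n k `&` G `&` X @^-1` C `&` Y @^-1` E) =
    (P (chain_event n k `&` G) *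
     (exponential_prob 1 C * exponential_prob (chain_rate k) E))%E.
  move=> mC mE.
  have := IHk E _ (upd (n - k.+1%:Z) C B) nk1 mE (mupd _ _ _ mC mB) Jlt'.
  rewrite capU// prodU// lawE// -/G -/p -/X -/Y => PE.
  rewrite PD [X in P X](_ : _ = chain_event n k `&` Y @^-1` E `&`
      (X @^-1` C `&` G)); last by apply/seteqP; split=> w /=; tauto.
  rewrite PE -!muleA; congr (_ * _)%E.
  by rewrite muleCA [RHS]muleC -muleA; congr (_ * _)%E; rewrite muleC.
have [m1 m1E] := exists_exponential_probability (1 : R) ltr01.
have [m2 m2E] := exists_exponential_probability _ rk0.
rewrite -m1E -m2E in XYlaw.
have := @probability_pair_law _ _ _ _ (measurableTypeR R) (measurableTypeR R) _
  P X Y m1 m2 _ (measurable_funPT X) (measurable_funPT Y) mD XYlaw _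
  (@measurable_ratio_ge _ theta _ mA).
rewrite m1E m2E exponential_prob_ratio_ge// ?ltW// PD => PS.
(* The new constraint and the event on [X] form one event on the pair [(X, Y)]; its mass brings the
   factor [1 / (1 + theta * chain_rate k)], the inverse of the next rate. *)
transitivity (P (chain_event n k `&` G `&`
    [set w | A (X w) /\ theta * X w <= Y w])).
  congr (P _); rewrite chain_eventS.
  by apply/seteqP; split=> w /=; rewrite -/X -/Y; tauto.
rewrite PS -chain_rateS// div1r big_nat_recr//= EFinM -/c.
by rewrite -!muleA; congr (_ * _)%E; rewrite muleA muleC -muleA.
Qed.

Lemma chain_event_prob (n : int) (k : nat) : -1 <= n - k%:Z ->
  P (chain_event n k) = (\prod_(0 <= l < k) (chain_rate l.+1)^-1)%:E.
Proof.
move=> n1; have := @chain_event_law n k setT fset0 (fun=> setT) n1 measurableT.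
move=> /(_ (fun=> measurableT)); rewrite preimage_setT setIT.
rewrite set_fset0 bigcap_set0 setIT big_seq_fset0 mule1 => -> //.
by rewrite exponential_prob_setT ?mule1 ?chain_rate_gt0.
Qed.

End ascending_chain.

(** * Application to the moving average, with [theta = - a1] *)

Lemma MA1_ge0 (R : realType) (T : Type) (a1 : R) (xi : int -> T -> R)
    (i : nat) (w : T) :
  (0 <= MA1 a1 xi i w) = (- a1 * xi (i%:Z - 1) w <= xi i%:Z w).
Proof. by rewrite -[RHS]subr_ge0 mulNr opprK. Qed.

Theorem proposition3p4 (R : realType) (d : measure_display)
    (T : measurableType d) (P : probability T R) (a1 : R)
    (xi : int -> {RV P >-> R}) :
  -1 < a1 < 0 ->
  iid_with_law [set i : int | -1 <= i] xi (exponential_prob 1) ->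
  exp_decay
    (fun n : nat =>
       P [set w | 0 <= running_min (MA1 a1 (fun i => xi i : T -> R)) n w])
    (1 + a1).
Proof.
move=> /andP[a1N1 a10] xi_iid.
have t01 : 0 < - a1 < 1 by rewrite oppr_gt0 a10 ltrNl.
have -> : 1 + a1 = 1 - (- a1) by rewrite opprK.
refine (@exp_decay_prod _ (fun k => (chain_rate (- a1 : R) k.+1)^-1)
  _ _ _ _ _ _).
- by rewrite subr_gt0; case/andP: t01.
- by move=> n; rewrite invr_gt0 chain_rate_gt0.
- exact: cvg_chain_rateV.
(* The n + 1 constraints start at index n and end exactly at index -1, the lowest one of the family;
   constraint [j] of the chain is the nonnegativity of the moving average at [n - j]. *)
move=> n; rewrite -(@chain_event_prob _ _ t01 _ _ _ _ xi_iid n%:Z); last by lia.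
congr (P _); apply/seteqP; split=> w /=; rewrite /running_min.
- move=> min_ge0 j jn.
  have := le_trans min_ge0
    (@ge_bigmin_seq _ _ _ (index_iota 0 n.+1) _ (n - j)%N xpredT _ _ isT).
  rewrite mem_index_iota ltnS leq_subr MA1_ge0 => /(_ isT).
  have -> : (n - j)%N%:Z = n%:Z - j%:Z by lia.
  by have -> : n%:Z - j%:Z - 1 = n%:Z - j.+1%:Z by lia.
- move=> chain.
  have Z_ge0 i : (i < n.+1)%N -> 0 <= MA1 a1 (fun i => xi i : T -> R) i w.
    move=> i_n; rewrite MA1_ge0; have := chain (n - i)%N.
    have -> : n%:Z - (n - i)%N%:Z = i%:Z by lia.
    have -> : n%:Z - (n - i).+1%:Z = i%:Z - 1 by lia.
    by apply; rewrite ltnS leq_subr.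
  (* The default value of the iterated minimum must be bounded too; it is the moving average at
     0. *)
  rewrite big_seq; apply: le_bigmin => [|i]; first exact: Z_ge0.
  by rewrite mem_index_iota; exact: Z_ge0.
Qed.
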